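(* Let $A\in\mathbb C^{N\times N}$. The set $\mathbf G_A^J$ of all graphs that are Jordan equivalent to $\mathcal G(A)$ is an equivalence class with respect to invariance of the graph Fourier transform. That is: Jordan equivalence is an equivalence relation, $\mathbf G_A^J$ is the class of $\mathcal G(A)$, and for every $\mathcal G(B)\in\mathbf G_A^J$ and every signal $s\in\mathbb C^N$ the graph Fourier transforms of $s$ over $\mathcal G(A)$ and over $\mathcal G(B)$ are equal, i.e. $\widehat s_{A,ij}=\widehat s_{B,ij}$ for all $i,j$.
   Context: $\mathcal G(A)$ is the (weighted, directed) graph with adjacency matrix $A\in\mathbb C^{N\times N}$. Each adjacency matrix is considered together with a chosen Jordan decomposition $A=VJV^{-1}$: $A$ has distinct eigenvalues $\lambda_1,\dots,\lambda_k$ with geometric multiplicities $g_i$; $J=J_A$ is block diagonal with upper triangular Jordan blocks of size $r_{ij}$ for $\lambda_i$ ($i=1,\dots,k$, $j=1,\dots,g_i$) in a fixed order; $V=[V_{ij}]$ is partitioned conformally, the columns of $V_{ij}\in\mathbb C^{N\times r_{ij}}$ being a Jordan chain of $\lambda_i$. The Jordan subspaces are $\mathscr J_{ij}=\mathrm{span}\{V_{ij}\}$ (column span), $\mathbf J_A=\{\mathscr J_{ij}\}_{ij}$ is the family of Jordan subspaces indexed by the blocks, and $\mathbb C^N=\bigoplus_{i,j}\mathscr J_{ij}$. Graph Fourier transform (GFT) of $s\in\mathbb C^N$ over $\mathcal G(A)$: the tuple $(\widehat s_{A,ij})_{i,j}$ of the unique vectors $\widehat s_{A,ij}\in\mathscr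 J_{ij}$ with $s=\sum_{i,j}\widehat s_{A,ij}$. Jordan equivalence: $\mathcal G(A)$ and $\mathcal G(B)$, with $A=VJ_AV^{-1}$ and $B=XJ_BX^{-1}$, are Jordan equivalent if (1) $J_A=J_B$ (for a fixed ordering of the Jordan blocks) and (2) $\mathbf J_A=\mathbf J_B$, i.e. $\mathrm{span}\{V_{ij}\}=\mathrm{span}\{X_{ij}\}$ for all $i,j$. *)

(* Defs.v *)
From mathcomp Require Import all_boot all_order all_algebra.
From mathcomp Require Import complex.
From mathcomp Require Import boolp classical_sets reals.

Set Implicit Arguments.
Unset Strict Implicit.
Unset Printing Implicit Defensive.

Import GRing.Theory.

Local Open Scope ring_scope.

Definition jordan_block (C : nzRingType) (c : C) (n : nat) : 'M[C]_n :=
  \matrix_(p, q) (c *+ (p == q) + (p.+1 == q :> nat)%:R).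

(* The eigenvalues jd_eig are pairwise distinct and all jd_gmul and jd_bsize  *)
(* are positive, so jd_eig lists each eigenvalue of A exactly once and        *)
(* jd_gmul i is the geometric multiplicity of jd_eig i. The cast only         *)
(* identifies N with the sum of the block sizes.                              *)
Record jordan_decomposition (R : realType) (N : nat) (A : 'M[R[i]]_N) :=
  JordanDecomposition {
  jd_neig : nat;
  jd_eig : 'I_jd_neig -> R[i];
  jd_gmul : 'I_jd_neig -> nat;
  jd_bsize : forall i : 'I_jd_neig, 'I_(jd_gmul i) -> nat;
  jd_dim : (\sum_(i < jd_neig) \sum_(j < jd_gmul i) jd_bsize j)%N = N;
  jd_V : 'M[R[i]]_N;
  jd_J : 'M[R[i]]_N :=
    castmx (jd_dim, jd_dim)
      (\mxdiag_(i < jd_neig) \mxdiag_(j < jd_gmul i)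
         jordan_block (jd_eig i) (jd_bsize j));
  jd_eig_inj : injective jd_eig;
  jd_gmul_gt0 : forall i, (0 < jd_gmul i)%N;
  jd_bsize_gt0 : forall (i : 'I_jd_neig) (j : 'I_(jd_gmul i)),
    (0 < jd_bsize j)%N;
  jd_V_unit : jd_V \in unitmx;
  jd_eq : A = jd_V *m jd_J *m invmx jd_V
}.

Arguments jd_neig {R N A} D : rename.
Arguments jd_eig {R N A} D i : rename.
Arguments jd_gmul {R N A} D i : rename.
Arguments jd_bsize {R N A} D {i} j : rename.
Arguments jd_dim {R N A} D : rename.
Arguments jd_V {R N A} D : rename.
Arguments jd_J {R N A} D : rename.

Record graph (R : realType) (N : nat) := Graph {
  adjmx : 'M[R[i]]_N;
  jdec : jordan_decomposition adjmx
}.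

Section JordanSubspaces.
Variables (R : realType) (N : nat) (G : graph R N).

Local Notation D := (jdec G).

Definition jordan_mx : 'M[R[i]]_N := jd_J D.

Definition jblock : Type := {i : 'I_(jd_neig D) & 'I_(jd_gmul D i)}.

Definition jblock_of (i : 'I_(jd_neig D)) (j : 'I_(jd_gmul D i)) : jblock :=
  Tagged (fun i => 'I_(jd_gmul D i)) j.

Definition jsize (b : jblock) : nat := jd_bsize D (tagged b).

Definition jchain (b : jblock) : 'M[R[i]]_(N, jsize b) :=
  submxrow (submxrow (castmx (erefl N, esym (jd_dim D)) (jd_V D)) (tag b))
           (tagged b).

Definition jspace (b : jblock) : {vspace 'cV[R[i]]_N} :=
  <<[seq col l (jchain b) | l : 'I_(jsize b)]>>%VS.

(* Families indexed by the blocks of two different graphs live over different *)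
(* index types. Listing them as sequences of sequences makes them comparable: *)
(* two listings are equal iff the index sets (i, j) are the same and the      *)
(* entries agree for all i, j.                                                *)
Definition jfamily (T : Type) (F : jblock -> T) : seq (seq T) :=
  [seq [seq F (jblock_of j) | j : 'I_(jd_gmul D i)] | i : 'I_(jd_neig D)].

Definition jordan_subspaces : seq (seq {vspace 'cV[R[i]]_N}) := jfamily jspace.

Definition is_gft (s : 'cV[R[i]]_N) (f : {ffun jblock -> 'cV[R[i]]_N}) : Prop :=
  (forall b, f b \in jspace b) /\ s = \sum_b f b.

Definition gft (s : 'cV[R[i]]_N) : {ffun jblock -> 'cV[R[i]]_N} :=
  xget 0 [set f | is_gft s f]%classic.

Definition gft_tuple (s : 'cV[R[i]]_N) : seq (seq 'cV[R[i]]_N) :=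
  jfamily (gft s).

Lemma jspaceP (b : jblock) (v : 'cV[R[i]]_N) :
  reflect (exists d : 'cV[R[i]]_(jsize b), v = jchain b *m d) (v \in jspace b).
Proof.
have colE (d : 'cV[R[i]]_(jsize b)) :
    jchain b *m d = \sum_l d l 0 *: col l (jchain b).
  apply/colP => p; rewrite !mxE summxE; apply: eq_bigr => l _.
  by rewrite !mxE mulrC.
apply: (iffP idP) => [vb | [d ->]]; last first.
  rewrite colE; apply: memv_suml => l _; apply: memvZ; apply: memv_span.
  exact: (fintype.image_f (fun l => col l (jchain b))).
pose X := [tuple col l (jchain b) | l < jsize b].
have XE : <<X>>%VS = jspace b by congr (<<_>>%VS).
exists (\col_l coord X l v); rewrite colE.
rewrite [LHS](@coord_span _ _ _ X) ?XE //; apply: eq_bigr => l _.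
by rewrite mxE (nth_map l) ?size_enum_ord // nth_ord_enum.
Qed.

Lemma jchain_sum (d : forall b : jblock, 'cV[R[i]]_(jsize b)) :
  castmx (erefl N, esym (jd_dim D)) (jd_V D) *m
    (\mxcol_i \mxcol_j d (jblock_of j)) =
  \sum_(b : jblock) jchain b *m d b.
Proof.
rewrite -[castmx _ _]submxrowK mul_mxrow_mxcol.
transitivity (\sum_i \sum_j jchain (@jblock_of i j) *m d (jblock_of j)).
  by apply: eq_bigr => i _; rewrite -[submxrow _ i]submxrowK mul_mxrow_mxcol.
by rewrite sig_big_dep /=; apply: eq_bigr => -[i j] _.
Qed.

Lemma jchain_bij (s : 'cV[R[i]]_N) :
  exists! d, castmx (erefl N, esym (jd_dim D)) (jd_V D) *m d = s.
Proof.
move: (jd_V_unit D); move: (jd_V D) => V.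
case: _ / (esym (jd_dim D)) => uV.
rewrite castmx_id; exists (invmx V *m s); split=> [|d <-].
  exact: mulKVmx.
exact: mulKmx.
Qed.

(* The Jordan subspaces are in direct sum and span the whole space, so that   *)
(* every signal has exactly one transform.                                    *)
Lemma is_gft_unique (s : 'cV[R[i]]_N) : exists! f, is_gft s f.
Proof.
have [d [dE dU]] := jchain_bij s.
pose c (b : jblock) := submxcol (submxcol d (tag b)) (tagged b).
have d_col : d = \mxcol_i \mxcol_j submxcol (submxcol d i) j.
  by rewrite -[LHS]submxcolK; apply/eq_mxcol => i; rewrite submxcolK.
exists [ffun b : jblock => jchain b *m c b].
split=> [|f [fJ sE]]; first split.
- by move=> b; rewrite ffunE; apply/jspaceP; exists (c b).
- rewrite -dE {1}d_col (jchain_sum c).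
  by apply: eq_bigr => b _; rewrite ffunE.
have fE b : exists e : 'cV_(jsize b), f b = jchain b *m e by apply/jspaceP.
pose e b := projT1 (cid (fE b)).
have eE b : f b = jchain b *m e b by exact: projT2 (cid (fE b)).
have /dU de : castmx (erefl N, esym (jd_dim D)) (jd_V D) *m
    (\mxcol_i \mxcol_j e (jblock_of j)) = s.
  by rewrite jchain_sum sE; apply: eq_bigr => b _.
by apply/ffunP => -[i j]; rewrite ffunE eE /c de /= !mxcolK.
Qed.

Lemma gft_spec (s : 'cV[R[i]]_N) : is_gft s (gft s).
Proof. by apply: xgetPex; have [f [fP _]] := is_gft_unique s; exists f. Qed.

End JordanSubspaces.

Definition jordan_equivalent (R : realType) (N : nat) (G H : graph R N) :
    Prop :=
  jordan_mx G = jordan_mx H /\ jordan_subspaces G = jordan_subspaces H.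

Definition jordan_class (R : realType) (N : nat) (G : graph R N) :
    set (graph R N) :=
  [set H | jordan_equivalent H G]%classic.

(* Main.v *)
Require Import Defs.
From mathcomp Require Import all_boot all_order all_algebra.
From mathcomp Require Import complex.
From mathcomp Require Import boolp classical_sets reals.

(** The graph Fourier transform is determined by the family of Jordan
    subspaces alone: it is the unique decomposition of the signal along their
    direct sum.  Equal families force equal index sets, so a transform over one
    graph, reindexed, satisfies the defining property of the transform over the
    other. *)

Local Open Scope ring_scope.
Local Open Scope classical_set_scope.

(** [jfamily] with its index data turned into free variables, so that equations between them can be
    eliminated by case analysis. *)
Definition tagged_family (n : nat) (g : 'I_n -> nat) (T : Type)
    (F : {i : 'I_n & 'I_(g i)} -> T) : seq (seq T) :=
  [seq [seq F (Tagged (fun i => 'I_(g i)) j) | j : 'I_(g i)] | i : 'I_n].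

Lemma codom_inj (I : finType) (T : Type) (F F' : I -> T) :
  codom F = codom F' -> F =1 F'.
Proof. by move/eq_in_map => FF' i; apply: FF'; rewrite mem_enum. Qed.

(** The outer lengths give [n = n'] and the inner ones [g = g']; after substitution [h] is the
    identity. The last clause lets families other than [F], such as the transforms, be carried along
    [h]. *)
Lemma tagged_family_inj {n : nat} {g : 'I_n -> nat} {n' : nat}
    {g' : 'I_n' -> nat} {T : Type} {F : {i : 'I_n & 'I_(g i)} -> T}
    {F' : {i : 'I_n' & 'I_(g' i)} -> T} :
  tagged_family n g T F = tagged_family n' g' T F' ->
  exists h : {i : 'I_n & 'I_(g i)} -> {i : 'I_n' & 'I_(g' i)},
    [/\ bijective h, F =1 F' \o h &
        forall (U : Type) (E : {i : 'I_n' & 'I_(g' i)} -> U),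
          tagged_family n g U (E \o h) = tagged_family n' g' U E].
Proof.
move=> FF'; have nn' : n = n'.
  by have := congr1 size FF'; rewrite !size_image !card_ord.
case: _ / nn' in g' F' FF' *; move/codom_inj: FF' => FF'.
have gg' : g = g'.
  apply/funext => i; have := congr1 size (FF' i).
  by rewrite !size_image !card_ord.
case: _ / gg' in F' FF' *.
exists id; split=> [|[i j]|//]; first by exists id.
exact: (codom_inj _ _ _ _ (FF' i) j).
Qed.

(** [gft] is an [xget] choice; uniqueness of the decomposition forces its value. *)
Lemma gft_eq (R : realType) (N : nat) (G : graph R N) (s : 'cV[R[i]]_N) f :
  is_gft s f -> gft G s = f.
Proof.
have [f0 [_ f0U]] := is_gft_unique G s.
by move=> /f0U <-; rewrite (f0U _ (gft_spec G s)).
Qed.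

Lemma gft_tuple_jordan_subspaces (R : realType) (N : nat) (G H : graph R N) :
  jordan_subspaces G = jordan_subspaces H ->
  forall s, gft_tuple G s = gft_tuple H s.
Proof.
(* Both sides are, by conversion, [tagged_family] applied to [jspace]. *)
move=> /tagged_family_inj [h [h_bij GH hE]] s.
have [memH sE] := gft_spec H s; rewrite /gft_tuple.
suff -> : gft G s = [ffun b => gft H s (h b)].
  rewrite -[RHS]hE; apply: eq_map => i; apply: eq_map => j; exact: ffunE.
apply: gft_eq; split=> [b|]; first by rewrite ffunE GH; apply: memH.
rewrite {1}sE (reindex h) /=; last exact: onW_bij.
by apply: eq_bigr => b _; rewrite ffunE.
Qed.

Lemma jordan_equivalent_equivalence (R : realType) (N : nat) :
  RelationClasses.Equivalence (@jordan_equivalent R N).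
Proof.
split=> [G|G H [JE SE]|G H K [JGH SGH] [JHK SHK]]; split=> //.
- by rewrite JGH.
- by rewrite SGH.
Qed.

Theorem theorem4 (R : realType) (N : nat) (A : 'M[R[i]]_N)
    (D : jordan_decomposition A) :
  let GA : graph R N := Graph D in
  [/\ RelationClasses.Equivalence (@jordan_equivalent R N),
      jordan_class GA = [set GB | jordan_equivalent GA GB] &
      forall GB : graph R N, jordan_class GA GB ->
        forall s : 'cV[R[i]]_N, gft_tuple GA s = gft_tuple GB s].
Proof.
(* Membership in [jordan_class GA] states the equality from [GB] to [GA], hence [esym]. *)
move=> GA; split=> [||GB [_ /esym]].
- exact: jordan_equivalent_equivalence.
- by apply/seteqP; split=> GB [eqJ eqS]; split.
- exact: gft_tuple_jordan_subspaces.
Qed.
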